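(* Let $W$ be a nondeterministic recursive probabilistic program (given by its control-flow graph) with a sampling function $\Upsilon$. Ranking measure functions are sound and complete for bounded termination of $W$; that is, for every non-terminal stack element $\mathfrak c$ of $W$, the program $W$ is boundedly terminating from $\mathfrak c$ (i.e. $\overline T(\mathfrak c)<\infty$) if and only if there exists a ranking measure function $h$ for $W$ with $h(\mathfrak c)<\infty$.
   Context: **Programs.** For a finite set $V$ of variables, $\mathrm{Val}_V$ is the set of functions (valuations) $V\to\mathbb Z$. A nondeterministic recursive probabilistic program $W$ is represented by its control-flow graph: a finite set $F$ of function names, a finite set $V_r$ of sampling variables and, for each $f\in F$: a finite set $V^f$ of program variables (write $\mathrm{Val}_f:=\mathrm{Val}_{V^f}$); a finite set $L^f$ of labels partitioned into branching labels $L_b^f$, assignment labels $L_a^f$, call labels $L_c^f$ and nondeterministic labels $L_d^f$; an initial label $\ell_{in}^f\in L^f$ and a terminal label $\ell_{out}^f\in L^f$ with $\ell_{in}^f\ne\ell_{out}^f$; and a set $\to_f$ of triples (source label, decoration, target label). For each $\ell\in L^f\setminus\{\ell_{out}^f\}$ the triples with source $\ell$ are: - if $\ell\in L_a^f$: exactly one triple $(\ell,u,\ell')$ with update function $u:\mathrm{Val}_f\times\mathrm{Val}_{V_r}\to\mathrm{Val}_f$; - if $\ell\in L_c^f$: exactly one triple $(\ell,(g,v),\ell')$ with $g\in F$ and value-passing function $v:\mathrm{Val}_f\to\mathrm{Val}_g$; - if $\ell\in L_b^f$: exactly two triples $(\ell,\phi,\ell_1),(\ell,\neg\phi,\ell_2)$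 with $\phi$ a propositional arithmetic predicate over $V^f$ (Boolean combination of comparisons of integer-valued arithmetic expressions); - if $\ell\in L_d^f$: exactly two triples $(\ell,\star,\ell_1),(\ell,\star,\ell_2)$ (the then-branch and the else-branch, respectively). **Sampling.** A sampling function $\Upsilon$ assigns to each $r\in V_r$ a discrete probability distribution on $\mathbb Z$; $\overline\Upsilon(\mu):=\prod_{r\in V_r}\Upsilon(r)(\mu(r))$ for $\mu\in\mathrm{Val}_{V_r}$, and $\mathrm{Val}^r:=\{\mu:\overline\Upsilon(\mu)>0\}$. **Semantics.** A stack element is a triple $(f,\ell,\nu)$ with $f\in F$, $\ell\in L^f$, $\nu\in\mathrm{Val}_f$; it is terminal if $\ell=\ell_{out}^f$. $\mathcal E$ is the set of stack elements. A configuration is a finite word (possibly the empty word $\varepsilon$) of non-terminal stack elements, the first letter being the top of the stack. For a stack element $\mathfrak d$ let $[\mathfrak d]$ be the one-letter word $\mathfrak d$ if $\mathfrak d$ is non-terminal and $\varepsilon$ otherwise. States are pairs $(w,\mu)$ of a configuration and $\mu\in\mathrm{Val}_{V_r}$. In one step from $((f,\ell,\nu)\cdot w,\mu)$, $\mu'$ is drawn with probability $\overline\Upsilon(\mu')$ and the next state is $(w',\mu')$ where - assignment: $w'=[(f,\ell',u(\nu,\mu'))]\cdot w$; - call: $w'=(g,\ell_{in}^g,v(\nu))\cdot[(f,\ell',\nu)]\cdot w$; - branching: $w'=[(f,\ell_1,\nu)]\cdot w$ if $\nu\models\phi$, and $w'=[(f,\ell_2,\nu)]\cdot w$ otherwise;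 - nondeterministic: $w'=[(f,\ell_1,\nu)]\cdot w$ under action $\mathbf{th}$ and $w'=[(f,\ell_2,\nu)]\cdot w$ under action $\mathbf{el}$. From $(\varepsilon,\mu)$ the next state is $(\varepsilon,\mu')$ with probability $\overline\Upsilon(\mu')$. In non-nondeterministic states there is effectively a single action $\tau$; when the top label is nondeterministic the enabled actions are $\mathbf{th},\mathbf{el}$. A history is a finite nonempty sequence of states in which each consecutive pair has positive transition probability under some action. A scheduler $\sigma$ maps every history to a probability distribution over the actions enabled at its last state. For a scheduler $\sigma$ and a non-terminal stack element $\mathfrak c$, $\mathbb P^\sigma_{\mathfrak c}$ (expectation $\mathbb E^\sigma_{\mathfrak c}$) is the induced probability measure on infinite sequences of states starting in $(\mathfrak c,\mathbf 0)$, where $\mathbf 0$ is the zero valuation. **Termination time.** $T(\{(w_n,\mu_n)\}_{n\ge0}):=\min\{n\ge 0: w_n=\varepsilon\}$ ($\min\emptyset=\infty$). $\overline T:\mathcal E\to[0,\infty]$ is $\overline T(\mathfrak c):=\sup_\sigma\mathbb E^\sigma_{\mathfrak c}(T)$ if $\mathfrak c$ is non-terminal (sup over all schedulers), and $\overline T(\mathfrak c):=0$ if terminal. $W$ is boundedly terminating from $\mathfrak c$ if $\overline T(\mathfrak c)<\infty$. **Ranking measure functions.** A ranking measure function for $W$ is a function $h:\mathcal E\to[0,\infty]$ for which there is $\epsilon\in(0,\infty)$ such that for all stack elements $(f,\ell,\nu)$: - (C1) if $\ell=\ell_{out}^f$ then $h(f,\ell,\nu)=0$; - (C2) if $\ell\in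 L_a^f\setminus\{\ell_{out}^f\}$ and $(\ell,u,\ell')$ is the only triple in $\to_f$ with source $\ell$: $\epsilon+\sum_{\mu\in\mathrm{Val}^r}\overline\Upsilon(\mu)\,h(f,\ell',u(\nu,\mu))\le h(f,\ell,\nu)$; - (C3) if $\ell\in L_c^f\setminus\{\ell_{out}^f\}$ and $(\ell,(g,v),\ell')$ is the only triple in $\to_f$ with source $\ell$: $\epsilon+h(g,\ell_{in}^g,v(\nu))+h(f,\ell',\nu)\le h(f,\ell,\nu)$; - (C4) if $\ell\in L_b^f\setminus\{\ell_{out}^f\}$ and $(\ell,\phi,\ell_1),(\ell,\neg\phi,\ell_2)$ are the two triples in $\to_f$ with source $\ell$: $\mathbf 1_{\nu\models\phi}h(f,\ell_1,\nu)+\mathbf 1_{\nu\models\neg\phi}h(f,\ell_2,\nu)+\epsilon\le h(f,\ell,\nu)$; - (C5) if $\ell\in L_d^f\setminus\{\ell_{out}^f\}$ and $(\ell,\star,\ell_1),(\ell,\star,\ell_2)$ are the two triples in $\to_f$ with source $\ell$: $\max\{h(f,\ell_1,\nu),h(f,\ell_2,\nu)\}+\epsilon\le h(f,\ell,\nu)$. Conventions: $d\cdot\infty=\infty$ for $d\in(0,\infty]$, $0\cdot\infty=0$. *)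

(* Defs.v *)
From HB Require Import structures.
From mathcomp Require Import all_boot all_order all_algebra.
From mathcomp Require Import all_classical all_reals all_analysis.

Set Implicit Arguments.
Unset Strict Implicit.
Unset Printing Implicit Defensive.
Import Order.TTheory GRing.Theory Num.Theory.
Local Open Scope classical_set_scope.
Local Open Scope ring_scope.

Definition valuation (V : finType) : countType := {ffun V -> int}.

(* Arithmetic expressions are embedded through their value functions, like the
   update and value-passing functions, so no expression grammar is imposed. *)
Inductive pred_arith (V : finType) : Type :=
| PLe of (valuation V -> int) & (valuation V -> int)
| PLt of (valuation V -> int) & (valuation V -> int)
| PEq of (valuation V -> int) & (valuation V -> int)
| PNot of pred_arith V
| PAnd of pred_arith V & pred_arith V
| POr of pred_arith V & pred_arith V.

Fixpoint satisfies (V : finType) (nu : valuation V) (phi : pred_arith V) : bool :=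
  match phi with
  | PLe e1 e2 => e1 nu <= e2 nu
  | PLt e1 e2 => e1 nu < e2 nu
  | PEq e1 e2 => e1 nu == e2 nu
  | PNot p => ~~ satisfies nu p
  | PAnd p q => satisfies nu p && satisfies nu q
  | POr p q => satisfies nu p || satisfies nu q
  end.

(* The decorated edges leaving one label of function [f]. The constructor
   records the class of the label (assignment, call, branching,
   nondeterministic); [Branch phi l1 l2] stands for the two edges decorated
   [phi] and [~ phi], and [Nondet l1 l2] for the then- and the else-edge. *)
Inductive edges (F Vr : finType) (pv lab : F -> finType) (f : F) : Type :=
| Assign of (valuation (pv f) -> valuation Vr -> valuation (pv f)) & lab f
| Call (g : F) of (valuation (pv f) -> valuation (pv g)) & lab f
| Branch of pred_arith (pv f) & lab f & lab f
| Nondet of lab f & lab f.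

(* [code f l] is meaningful only for [l != lout f]: neither the semantics nor
   ranking measure functions look at [code f (lout f)]. *)
Record program : Type := Program {
  fname : finType;
  svar : finType;
  pvar : fname -> finType;
  label : fname -> finType;
  lin : forall f, label f;
  lout : forall f, label f;
  lin_neq_lout : forall f, lin f != lout f;
  code : forall f, label f -> edges svar pvar label f
}.

Section Semantics.
Context (W : program).

Definition frame (f : fname W) : countType := (label f * valuation (pvar f))%type.

Definition stack_elt : countType := {f : fname W & frame f}.

Definition elt (f : fname W) (l : label f) (nu : valuation (pvar f)) : stack_elt :=
  Tagged frame ((l, nu) : frame f).

Definition terminal (e : stack_elt) : bool :=
  (tagged e).1 == lout (tag e).

Definition config : countType := seq {e : stack_elt | ~~ terminal e}.

(* [push e w] is the word written [e] . w, where [e] is the one-letter word e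
   if e is non-terminal and the empty word otherwise. *)
Definition push (e : stack_elt) (w : config) : config :=
  if insub e is Some d then d :: w else w.

Definition state : Type := (config * valuation (svar W))%type.
HB.instance Definition _ := Countable.on state.
HB.instance Definition _ := isPointed.Build state ([::], [ffun=> 0]).

Inductive action : Type := tau | th | el.

Definition is_nondet (w : config) : bool :=
  if w is d :: _ then
    let: existT f (l, _) := \val d in
    if code l is Nondet _ _ then true else false
  else false.

Definition enabled (w : config) (a : action) : bool :=
  if a is tau then ~~ is_nondet w else is_nondet w.

Definition next_config (w : config) (a : action) (mu : valuation (svar W)) : config :=
  if w is d :: w' then
    let: existT f (l, nu) := \val d in
    match code l with
    | Assign u l' => push (elt l' (u nu mu)) w'
    | Call g v l' => push (elt (lin g) (v nu)) (push (elt l' nu) w')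
    | Branch phi l1 l2 => push (elt (if satisfies nu phi then l1 else l2) nu) w'
    | Nondet l1 l2 => push (elt (if a is el then l2 else l1) nu) w'
    end
  else [::].

Definition cylinder (s0 : state) (s : seq state) : set (nat -> state) :=
  [set w | forall i, (i <= size s)%N -> w i = nth s0 (s0 :: s) i].

(* Infinite sequences of states, with the sigma-algebra generated by the
   cylinders. *)
Definition run := g_sigma_algebraType
  [set A | exists s0 s, A = cylinder s0 s].

Variable R : realType.

Record sampling : Type := Sampling {
  pmf :> svar W -> int -> R;
  pmf_ge0 : forall r z, 0 <= pmf r z;
  pmf_sum1 : forall r, (\esum_(z in [set: int]) (pmf r z)%:E = 1)%E
}.

Variable U : sampling.

Definition sprob (mu : valuation (svar W)) : R := \prod_(r : svar W) U r (mu r).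

Definition trans_prob (s : state) (a : action) (s' : state) : R :=
  if enabled s.1 a && (s'.1 == next_config s.1 a s'.2) then sprob s'.2 else 0.

Definition possible (s s' : state) : bool :=
  [|| 0 < trans_prob s tau s', 0 < trans_prob s th s' | 0 < trans_prob s el s'].

(* A nonempty sequence of states is given by its first state [s0] and the
   remaining ones [s]; its last state is [last s0 s], and it is a history iff
   [path possible s0 s]. The values of [sched] outside histories are
   irrelevant: there [path_prob] below has a zero transition factor. *)
Record scheduler : Type := Scheduler {
  sched :> state -> seq state -> action -> R;
  sched_ge0 : forall s0 s, path possible s0 s -> forall a, 0 <= sched s0 s a;
  sched_enabled : forall s0 s, path possible s0 s ->
    forall a, ~~ enabled (last s0 s).1 a -> sched s0 s a = 0;
  sched_sum1 : forall s0 s, path possible s0 s ->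
    sched s0 s tau + sched s0 s th + sched s0 s el = 1
}.

Definition step_prob (sigma : scheduler) (s0 : state) (s : seq state)
    (s' : state) : R :=
  sigma s0 s tau * trans_prob (last s0 s) tau s' +
  sigma s0 s th * trans_prob (last s0 s) th s' +
  sigma s0 s el * trans_prob (last s0 s) el s'.

Definition path_prob (sigma : scheduler) (s0 : state) (s : seq state) : R :=
  \prod_(i < size s) step_prob sigma s0 (take i s) (nth s0 s i).

Definition init (c : stack_elt) : state := (push c [::], [ffun=> 0]).

(* [P] is the measure induced by [sigma] from the initial state of [c]. It
   exists by the Ionescu-Tulcea theorem and is unique, since the cylinders
   together with the empty set are closed under intersection. *)
Definition induced (sigma : scheduler) (c : stack_elt)
    (P : probability run R) : Prop :=
  forall s0 s, P (cylinder s0 s) =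
    (if s0 == init c then path_prob sigma s0 s else 0)%:E.

Definition term_time (w : run) : \bar R :=
  ereal_inf [set n%:R%:E | n in [set n | (w n).1 = [::]]].

Definition Tbar (c : stack_elt) : \bar R :=
  if terminal c then 0%E else
  ereal_sup [set x | exists (sigma : scheduler) (P : probability run R),
    induced sigma c P /\ x = (\int[P]_w term_time w)%E].

Definition boundedly_terminating (c : stack_elt) : Prop := (Tbar c < +oo)%E.

Local Open Scope ereal_scope.

Definition ranking (h : stack_elt -> \bar R) : Prop :=
  (forall e, 0 <= h e) /\
  exists eps : R, (0 < eps)%R /\
  forall (f : fname W) (l : label f) (nu : valuation (pvar f)),
    (l = lout f -> h (elt l nu) = 0) /\
    (l <> lout f ->
      match code l with
      | Assign u l' =>
          eps%:E + \esum_(mu in [set mu | (0 < sprob mu)%R])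
            (sprob mu)%:E * h (elt l' (u nu mu)) <= h (elt l nu)
      | Call g v l' =>
          eps%:E + h (elt (lin g) (v nu)) + h (elt l' nu) <= h (elt l nu)
      | Branch phi l1 l2 =>
          ((satisfies nu phi)%:R)%:E * h (elt l1 nu) +
          ((~~ satisfies nu phi)%:R)%:E * h (elt l2 nu) + eps%:E <= h (elt l nu)
      | Nondet l1 l2 =>
          maxe (h (elt l1 nu)) (h (elt l2 nu)) + eps%:E <= h (elt l nu)
      end).

End Semantics.

(* Main.v *)
From Pilot Require (* [all_analysis] also defines [induced] and [pmf_ge0]. *)
Import Defs.
From HB Require Import structures.
From mathcomp Require Import all_boot all_order all_algebra.
From mathcomp Require Import all_classical all_reals all_analysis.
From mathcomp Require Import measurable_realfun.

(* Soundness: if h is a ranking measure function, the sum of h over the stack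
   bounds eps times the expected number of steps before termination, whatever
   the scheduler.

   Completeness: let rank_n be the n-th iterate, starting from 0, of the operator
   given by (C1)-(C5) with eps = 1 and equalities; its supremum is a ranking
   measure function by monotone convergence. Let V(w) be the supremum over n of
   the optimal expectation of min(T, n) from the configuration w. Induction on n
   gives rank_n(e) + V(w) <= V(e w), so the supremum is at most V(c) at c. The
   greedy scheduler for horizon n attains the n-th optimal expectation, whence
   V(c) <= Tbar(c). Its induced measure is the image of Lebesgue measure on
   [0, 1[ under a coding of independent samples by nested intervals. *)

Set Implicit Arguments.
Unset Strict Implicit.
Unset Printing Implicit Defensive.
Import Defs.
Import Order.TTheory GRing.Theory Num.Theory.
Local Open Scope classical_set_scope.
Local Open Scope ring_scope.

(** * Countable sums *)

Section CountableSums.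
Local Open Scope ereal_scope.
Context {R : realType}.

(** Both suprema are limits of monotone sequences, and limits add because nonnegativity rules out
    [+oo - oo]. *)
Lemma adde_ereal_sup (u v : nat -> \bar R) :
  (forall n, 0 <= u n) -> (forall n, 0 <= v n) ->
  {homo u : n m / (n <= m)%N >-> n <= m} ->
  {homo v : n m / (n <= m)%N >-> n <= m} ->
  ereal_sup (range u) + ereal_sup (range v) =
  ereal_sup (range (fun n => u n + v n)).
Proof.
move=> u0 v0 ndu ndv.
have su : 0 <= ereal_sup (range u).
  by apply: le_trans (u0 0%N) _; apply: ereal_sup_ubound; exists 0%N.
have sv : 0 <= ereal_sup (range v).
  by apply: le_trans (v0 0%N) _; apply: ereal_sup_ubound; exists 0%N.
have h1 := cvgeD (ge0_adde_def su sv) (ereal_nondecreasing_cvgn ndu)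
  (ereal_nondecreasing_cvgn ndv).
have h2 : {homo (fun n => u n + v n) : n m / (n <= m)%N >-> n <= m}.
  by move=> n m nm; apply: leeD; [exact: ndu|exact: ndv].
rewrite -(cvg_lim (@ereal_hausdorff R) (h1 _)).
exact: (cvg_lim (@ereal_hausdorff R) (ereal_nondecreasing_cvgn h2)).
Qed.

Lemma addel_ereal_sup (c : \bar R) (u : nat -> \bar R) : 0 <= c ->
  (forall n, 0 <= u n) -> {homo u : n m / (n <= m)%N >-> n <= m} ->
  c + ereal_sup (range u) = ereal_sup (range (fun n => c + u n)).
Proof.
move=> c0 u0 ndu; rewrite -(@adde_ereal_sup (fun=> c))//; congr (_ + _).
rewrite [X in ereal_sup X](_ : _ = [set c]) ?ereal_sup1//.
by apply/seteqP; split=> [_ [n _ <-]//|_ ->]; exists 0%N.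
Qed.

(** The half of monotone convergence used below: the left sum is a supremum of finite sums, through
    which suprema pass by [adde_ereal_sup]. *)
Lemma esum_ereal_sup_le (T : choiceType) (D : set T) (f : nat -> T -> \bar R) :
  (forall n t, 0 <= f n t) ->
  (forall t, {homo f^~ t : n m / (n <= m)%N >-> n <= m}) ->
  \esum_(t in D) ereal_sup (range (f^~ t)) <=
  ereal_sup (range (fun n => \esum_(t in D) f n t)).
Proof.
move=> f0 ndf; apply: ge_ereal_sup => _ [X [finX XD] <-].
rewrite fsbig_finite//=.
have -> (s : seq T) : (\sum_(i <- s) ereal_sup (range (f^~ i)))%R =
    ereal_sup (range (fun n => (\sum_(i <- s) f n i)%R)).
  elim: s => [|t s IH].
    rewrite big_nil [X in ereal_sup X](_ : _ = [set 0]) ?ereal_sup1//.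
    apply/seteqP; split=> [_ [n _ <-]|_ ->]; first by rewrite big_nil.
    by exists 0%N => //; rewrite big_nil.
  rewrite big_cons IH adde_ereal_sup//; last 2 first.
  - by move=> n; exact: sume_ge0.
  - by move=> n m nm; apply: lee_sum => i _; exact: ndf.
  by congr ereal_sup; apply/seteqP; split=> _ [n _ <-]; exists n => //;
    rewrite big_cons.
apply: ge_ereal_sup => _ [n _ <-].
apply: le_trans (ereal_sup_ubound _); last by exists n.
by apply: ereal_sup_ubound; exists X => //; rewrite fsbig_finite.
Qed.

(** Transfers results on series to countable types: naturals that code no element contribute 0. *)
Lemma esum_countable (T : countType) (a : T -> \bar R) :
  (forall t, 0 <= a t) ->
  \esum_(t in [set: T]) a t = \sum_(k <oo) oapp a 0 (pickle_inv k).
Proof.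
move=> a0; have oa0 k : 0 <= oapp a 0 (pickle_inv k) by case: pickle_inv => /=.
rewrite nneseries_esumT//.
rewrite (_ : \esum_(k in [set: nat]) _ =
    \esum_(k in range (@pickle T)) oapp a 0 (pickle_inv k)).
  rewrite esum_image; last by move=> x y _ _; exact: (pcan_inj pickleK).
  by apply: eq_esum => t _; rewrite pickleK_inv.
rewrite [RHS]esum_mkcond; apply: eq_esum => k _; case: ifPn => //.
case E : (pickle_inv k) => [t|]//= /negP[]; rewrite inE; exists t => //.
by have := @pickle_invK T k; rewrite E.
Qed.

Lemma ge0_esumZl (T : countType) (D : set T) (c : R) (a : T -> \bar R) :
  (0 <= c)%R -> (forall t, 0 <= a t) ->
  \esum_(t in D) (c%:E * a t) = c%:E * \esum_(t in D) a t.
Proof.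
move=> c0 a0; rewrite esum_mkcond [in RHS]esum_mkcond !esum_countable.
- rewrite -nneseriesZl; last first.
    by move=> k _; case: pickle_inv => //= t; case: ifP.
  apply: eq_eseriesr => k _; case: pickle_inv => [t|]/=; last by rewrite mule0.
  by case: ifP; rewrite ?mule0.
- by move=> t; case: ifP.
- by move=> t; case: ifP => // _; rewrite mule_ge0.
Qed.

Lemma measure_esum d (X : measurableType d) (mu : {measure set X -> \bar R})
    (T : countType) (F : T -> set X) :
  (forall t, measurable (F t)) -> trivIset [set: T] F ->
  mu (\bigcup_t F t) = \esum_(t in [set: T]) mu (F t).
Proof.
move=> mF tF; pose G k := oapp F set0 (pickle_inv k).
have mG k : measurable (G k).
  by rewrite /G; case: pickle_inv => //= t; exact: mF.
have -> : \bigcup_t F t = \bigcup_k G k.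
  apply/seteqP; split=> x [i _ Fx].
    by exists (pickle i) => //; rewrite /G pickleK_inv.
  by move: Fx; rewrite /G; case: pickle_inv => //= t Fx; exists t.
rewrite measure_semi_bigcup//; last 2 first.
- apply/trivIsetP => i j _ _ ij; rewrite /G.
  have := @pickle_invK T i; have := @pickle_invK T j.
  case: (pickle_inv i) => [s|]/=; last by rewrite set0I.
  case: (pickle_inv j) => [t|]/=; last by rewrite setI0.
  move=> tj si; move/trivIsetP : tF => /(_ s t); apply => //.
  by apply: contra ij => /eqP st; rewrite -si -tj st.
- exact: bigcupT_measurable.
rewrite esum_countable//; apply: eq_eseriesr => k _.
by rewrite /G; case: pickle_inv => //=; rewrite measure0.
Qed.

End CountableSums.

(** Makes [sprob] a probability distribution. The induction frees one coordinate at a time, the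
    others being frozen at [t0]; by Tonelli each freed coordinate contributes a factor 1. *)
Lemma esum_prod_ffun {R : realType} (V : finType) (T : countType) (t0 : T)
    (p : V -> T -> R) :
  (forall r t, 0 <= p r t) ->
  (forall r, \esum_(t in [set: T]) (p r t)%:E = 1)%E ->
  (\esum_(g in [set: {ffun V -> T}]) (\prod_r p r (g r))%:E = 1)%E.
Proof.
move=> p0 p1; pose S (s : seq V) :=
  [set g : {ffun V -> T} | forall r, r \notin s -> g r = t0].
suff key (s : seq V) : uniq s ->
    (\esum_(g in S s) (\prod_(r <- s) p r (g r))%:E = 1)%E.
  have := key (index_enum V) (index_enum_uniq V).
  rewrite (_ : S _ = setT)//; apply/seteqP; split=> // g _ r.
  by rewrite mem_index_enum.
elim: s => [_|r s IH /= /andP[rs us]].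
  rewrite (_ : S _ = [set [ffun=> t0]]); last first.
    apply/seteqP; split=> [g Sg|_ -> r _]/=; last by rewrite ffunE.
    by apply/ffunP => r; rewrite ffunE; apply: Sg.
  by rewrite esum_set1 ?big_nil// lee_fin.
(* As [r] is not in [s], every member of [S s] takes the value [t0] at [r], so overwriting that
   value is a bijection from [T * S s] onto [S (r :: s)]. *)
pose upd (x : T * {ffun V -> T}) : {ffun V -> T} :=
  [ffun y => if y == r then x.1 else x.2 y].
rewrite (reindex_esum (setT `*`` fun=> S s) _ upd); last first.
  split.
  - move=> [t g] [_ /= Sg] y; rewrite inE negb_or ffunE => /andP[/negPf -> ys].
    exact: Sg.
  - move=> [t g] [t' g']; rewrite !inE => -[_ /= Sg] [_ /= Sg'] /ffunP eg.
    have := eg r; rewrite !ffunE eqxx /= => ->; congr pair.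
    apply/ffunP => y; have := eg y; rewrite !ffunE.
    by case: eqP => [->|//]; rewrite Sg// Sg'.
  - move=> g Sg; exists (g r, [ffun y => if y == r then t0 else g y]).
      split=> //= y ys; rewrite ffunE; case: eqP => // /eqP yr.
      by apply: Sg; rewrite inE negb_or yr.
    by apply/ffunP => y; rewrite !ffunE /=; case: eqP => [->|].
rewrite -(esum_esum (I := setT) (J := fun=> S s)
  (a := fun t g => (\prod_(y <- r :: s) p y (upd (t, g) y))%:E)); last first.
  by move=> t g _ _; rewrite lee_fin prodr_ge0.
rewrite -(p1 r); apply: eq_esum => t _.
rewrite -[RHS]mule1 -(IH us) -ge0_esumZl//; last first.
  by move=> g; rewrite lee_fin prodr_ge0.
apply: eq_esum => g _; rewrite big_cons ffunE eqxx EFinM; congr (_ * _%:E)%E.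
rewrite !big_seq; apply: eq_bigr => y ys; rewrite ffunE.
by case: eqP ys rs => // -> ->.
Qed.

(** * Independent samples on the unit interval *)

Lemma lebesgue_measure_itvco {R : realType} (a b : R) : a <= b ->
  lebesgue_measure (`[a, b[ : set R) = (b - a)%:E.
Proof.
move=> ab; rewrite lebesgue_measure_itv/= lte_fin.
by case: ltgtP ab => // -> _; rewrite subrr.
Qed.

Section IidSequences.
Context {R : realType} (T : countType) (t0 : T) (q : T -> R).
Hypothesis q0 : forall t, 0 <= q t.
Hypothesis q1 : (\esum_(t in [set: T]) (q t)%:E = 1)%E.

Let q_nat (k : nat) : R := oapp q 0 (pickle_inv k).

Let q_nat0 k : 0 <= q_nat k.
Proof. by rewrite /q_nat; case: pickle_inv => /=. Qed.

Definition cumul (t : T) : R := \sum_(0 <= k < pickle t) q_nat k.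

Let cumulS t : cumul t + q t = \sum_(0 <= k < (pickle t).+1) q_nat k.
Proof. by rewrite big_nat_recr//= /q_nat pickleK_inv. Qed.

Let q_nat_sum_le m n : (m <= n)%N ->
  \sum_(0 <= k < m) q_nat k <= \sum_(0 <= k < n) q_nat k.
Proof.
by move=> mn; rewrite [leRHS](big_cat_nat (leq0n m) mn)/= lerDl sumr_ge0.
Qed.

Let q_nat_sum : (\sum_(k <oo) (q_nat k)%:E = 1)%E.
Proof.
rewrite -q1 esum_countable; last by move=> t; rewrite lee_fin.
by apply: eq_eseriesr => k _; rewrite /q_nat; case: pickle_inv.
Qed.

Let q_nat_sum_le1 n : \sum_(0 <= k < n) q_nat k <= 1.
Proof.
rewrite -lee_fin -q_nat_sum -sumEFin.
by apply: nneseries_lim_ge => k _; rewrite lee_fin.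
Qed.

Let cumul0 t : 0 <= cumul t.
Proof. by rewrite sumr_ge0. Qed.

Let cumul1 t : cumul t + q t <= 1.
Proof. by rewrite cumulS. Qed.

(** The partial sums of [q_nat] tend to 1, so there is a first one above [u]; the index of its last
    term codes [t]. *)
Lemma cumul_cover u : 0 <= u < 1 -> exists t, cumul t <= u < cumul t + q t.
Proof.
move=> /andP[u0 u1].
have [n un] : exists n, u < \sum_(0 <= k < n) q_nat k.
  apply/not_existsP => h; suff : (1 <= u%:E)%E by rewrite lee_fin leNgt u1.
  rewrite -q_nat_sum; apply: lime_le.
    by apply: is_cvg_nneseries => k _ _; rewrite lee_fin.
  by apply: nearW => n; rewrite sumEFin lee_fin leNgt; apply/negP/h.
have exn : exists n, u < \sum_(0 <= k < n) q_nat k by exists n.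
case: (ex_minnP exn) => -[|k]; first by rewrite big_geq// ltNge u0.
move=> uk mink; have uk' : \sum_(0 <= i < k) q_nat i <= u.
  by rewrite leNgt; apply/negP => /mink; rewrite ltnn.
(* Crossing [u] forces [0 < q_nat k], hence [k] is the code of an element. *)
have := le_lt_trans uk' uk; rewrite big_nat_recr//= ltrDl {1}/q_nat.
case E : (pickle_inv k) => [t|]; last by rewrite ltxx.
have ptk : pickle t = k by have := @pickle_invK T k; rewrite E.
by move=> _; exists t; rewrite cumulS /cumul ptk uk'.
Qed.

Lemma cumul_inj u t t' : cumul t <= u < cumul t + q t ->
  cumul t' <= u < cumul t' + q t' -> t = t'.
Proof.
have lt_absurd s s' : cumul s <= u < cumul s + q s ->
    cumul s' <= u < cumul s' + q s' -> ~ (pickle s < pickle s')%N.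
  move=> /andP[_ us] /andP[us' _] /q_nat_sum_le; rewrite -cumulS => ss'.
  by have := le_lt_trans (le_trans ss' us') us; rewrite ltxx.
move=> ut ut'; apply: (pcan_inj pickleK).
case: (ltngtP (pickle t) (pickle t')) => // [/lt_absurd|/lt_absurd].
  by move=> /(_ ut ut').
by move=> /(_ ut' ut).
Qed.

(* The intervals [cumul t, cumul t + q t[ partition [0, 1[: [digit u] is the index
   of the one that contains [u], and [rest u] is the position of [u] in it,
   rescaled to [0, 1[. *)
Definition digit (u : R) : T := xget t0 [set t | cumul t <= u < cumul t + q t].

Definition rest (u : R) : R := (u - cumul (digit u)) / q (digit u).

Definition digits (u : R) (i : nat) : T := digit (iter i rest u).

Lemma digitP u t : 0 <= u < 1 ->
  digit u = t <-> cumul t <= u < cumul t + q t.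
Proof.
move=> u01; rewrite /digit; case: xgetP => [s -> us|h].
  by split=> [<-//|]; exact: cumul_inj us.
by have [s us] := cumul_cover u01; case: (h s us).
Qed.

Definition seq_cylinder (s : seq T) : set (nat -> T) :=
  [set x | forall i, (i < size s)%N -> x i = nth t0 s i].

(* Left end of the interval of the points whose first digits are [s]; the length
   of this interval is [weight s]. *)
Fixpoint low (s : seq T) : R :=
  if s is t :: s' then cumul t + q t * low s' else 0.

Definition weight (s : seq T) : R := \prod_(t <- s) q t.

Lemma weight_ge0 s : 0 <= weight s. Proof. by rewrite prodr_ge0. Qed.

Lemma low_bounds s : 0 <= low s /\ low s + weight s <= 1.
Proof.
rewrite /weight; elim: s => [|t s [l0 l1]]/=; first by rewrite big_nil add0r.
rewrite big_cons; split; first by rewrite addr_ge0// mulr_ge0.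
rewrite -addrA -mulrDr; apply: le_trans (cumul1 t).
by rewrite lerD2l -[leRHS]mulr1 ler_wpM2l.
Qed.

(** Induction on [s]: the affine map from [0, 1[ onto the interval of [t] carries the interval of
    [s] onto that of [t :: s], and [rest] inverts it. *)
Lemma seq_cylinder_digits s u : 0 <= u < 1 ->
  seq_cylinder s (digits u) <-> low s <= u < low s + weight s.
Proof.
rewrite /weight; elim: s u => [|t s IH] u u01.
  by rewrite big_nil add0r /= u01; split.
rewrite big_cons /=; have [l0 l1] := low_bounds s.
have consE : seq_cylinder (t :: s) (digits u) <->
    digit u = t /\ seq_cylinder s (digits (rest u)).
  split=> [h|[ht hs]].
    split; first exact: (h 0%N).
    by move=> i si; have := h i.+1 si; rewrite /digits iterSr.
  by case=> [|i] si //; rewrite /digits iterSr; exact: hs.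
rewrite consE -addrA -mulrDr.
(* An interval that contains a point has positive length, so the division by [q t] in [rest] is
   genuine. *)
have restE : digit u = t -> 0 < q t /\ 0 <= rest u < 1 /\
    rest u = (u - cumul t) / q t.
  move=> ut; move: (ut) => /(digitP _ u01)/andP[tu ut'].
  have qt : 0 < q t by have := le_lt_trans tu ut'; rewrite ltrDl.
  rewrite /rest ut; split=> //; split=> //.
  by rewrite divr_ge0 ?subr_ge0//= ltr_pdivrMr// mul1r ltrBlDl.
split=> [[ut]|].
  have [qt [r01 rE]] := restE ut.
  move=> /(IH _ r01); rewrite rE ler_pdivlMr// ltr_pdivrMr// lerBrDl ltrBlDl.
  by rewrite ![_ * q t]mulrC.
move=> /andP[lu ul].
have ut : digit u = t.
  apply/(digitP _ u01); rewrite (le_trans _ lu) ?lerDl ?mulr_ge0//=.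
  by apply: lt_le_trans ul _; rewrite lerD2l -[leRHS]mulr1 ler_wpM2l.
have [qt [r01 rE]] := restE ut.
split=> //; apply/(IH _ r01); rewrite rE.
by rewrite ler_pdivlMr// ltr_pdivrMr// lerBrDl ltrBlDl ![_ * q t]mulrC lu.
Qed.

Definition uniform01 : set (measurableTypeR R) -> \bar R :=
  mrestr lebesgue_measure (measurable_itv `[0, 1[).

HB.instance Definition _ := Measure.on uniform01.

Let uniform01_setT : uniform01 setT = 1%E.
Proof.
rewrite /uniform01 /mrestr setTI lebesgue_measure_itv/=.
by rewrite lte_fin ltr01 oppr0 adde0.
Qed.

HB.instance Definition _ :=
  Measure_isProbability.Build _ _ _ uniform01 uniform01_setT.

(** [P] is the law of [rho] applied to the digits of a uniform point. The hypothesis on the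
    generators makes this map measurable, and [seq_cylinder_digits] turns probabilities into
    interval lengths. *)
Lemma iid_distribution d (Y : measurableType d) (G : set (set Y))
    (rho : (nat -> T) -> Y) :
  measurable = <<s G>> ->
  (forall A, G A ->
    rho @^-1` A = set0 \/ exists s, rho @^-1` A = seq_cylinder s) ->
  exists P : probability Y R, forall A,
    (rho @^-1` A = set0 -> P A = 0)%E /\
    forall s, rho @^-1` A = seq_cylinder s -> P A = (weight s)%:E.
Proof.
move=> GE hG.
(* The value [point] outside [0, 1[ is arbitrary: [uniform01] gives no mass there. *)
pose f (u : measurableTypeR R) : Y :=
  if u \in `[0, 1[ then rho (digits u) else point.
have fI A s : rho @^-1` A = seq_cylinder s ->
    f @^-1` A `&` `[0, 1[ = `[low s, low s + weight s[%classic.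
  move=> /seteqP[As sA]; apply/seteqP; split=> u /=.
    rewrite /f => -[]; case: ifPn => // u01 Au _; rewrite in_itv/=.
    by apply/seq_cylinder_digits; [move: u01; rewrite in_itv|exact: As].
  rewrite in_itv/= => lu; have [l0 l1] := low_bounds s.
  have u01 : 0 <= u < 1.
    case/andP: lu => lu ul.
    by rewrite (le_trans l0 lu)/= (lt_le_trans ul l1).
  rewrite /f in_itv/= u01; split=> //; apply: sA.
  exact/seq_cylinder_digits.
have fI0 A : rho @^-1` A = set0 -> f @^-1` A `&` `[0, 1[ = set0.
  move=> A0; apply/seteqP; split=> u //=; rewrite /f => -[].
  by case: ifPn => // _ Au _; rewrite -[False]/(set0 (digits u)) -A0.
have mf : measurable_fun setT f.
  apply: (measurability G) => // _ [A GA <-]; rewrite setTI.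
  (* Inside [0, 1[ the preimage is empty or an interval; outside, [f] is constant. *)
  rewrite -(setIT (f @^-1` A)) -(setUv (`[0, 1[%classic : set R)) setIUr.
  apply: measurableU.
    by case: (hG A GA) => [/fI0 ->//|[s /fI ->]]; exact: measurable_itv.
  rewrite (_ : _ `&` ~` _ = (fun=> point) @^-1` A `&` ~` `[0, 1[%classic).
    apply: measurableI; rewrite ?preimage_cst; last exact: measurableC.
    by case: ifP.
  apply/seteqP; split=> u /=; rewrite /f => -[Au /negP u01]; split=> //.
    by move: Au; rewrite (negbTE u01).
  exact/negP.
  by rewrite (negbTE u01).
  exact/negP.
pose X : {mfun measurableTypeR R >-> Y} := mfun_Sub (mem_set mf).
exists (distribution uniform01 X) => A; split=> [A0|s As].
  rewrite /distribution /pushforward /= /uniform01 /mrestr.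
  by rewrite fI0// measure0.
rewrite /distribution /pushforward /= /uniform01 /mrestr.
have [l0 l1] := low_bounds s.
by rewrite (fI _ _ As) lebesgue_measure_itvco ?lerDl ?weight_ge0// addrC addKr.
Qed.

End IidSequences.

(** * Means and conditional numbers of steps *)

Section Program.
Context {R : realType} {W : program} (U : sampling W R).
Local Open Scope ereal_scope.
Implicit Types (w : config W) (a : action) (mu : valuation (svar W)).

Lemma sprob_ge0 mu : (0 <= sprob U mu)%R.
Proof. by apply: prodr_ge0 => r _; exact: pmf_ge0. Qed.

Lemma esum_sprob : \esum_(mu in [set: valuation (svar W)]) (sprob U mu)%:E = 1.
Proof.
exact: (esum_prod_ffun (0 : int)%R (pmf_ge0 U) (pmf_sum1 U)).
Qed.

Definition mean (f : valuation (svar W) -> \bar R) : \bar R :=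
  \esum_(mu in [set: valuation (svar W)]) ((sprob U mu)%:E * f mu).

(** Links (C2), which sums over the support, to [mean]: a sample of probability 0 contributes 0 even
    where [f] is infinite. *)
Lemma mean_supp f :
  \esum_(mu in [set mu | (0 < sprob U mu)%R]) ((sprob U mu)%:E * f mu) = mean f.
Proof.
rewrite esum_mkcond; apply: eq_esum => mu _; case: ifPn => //.
rewrite notin_setE /= => /negP; rewrite -leNgt => sp.
by rewrite (_ : sprob U mu = 0%R) ?mul0e//; apply/le_anti; rewrite sp sprob_ge0.
Qed.

Lemma mean_ge0 f : (forall mu, 0 <= f mu) -> 0 <= mean f.
Proof.
by move=> f0; apply: esum_ge0 => mu _; rewrite mule_ge0// lee_fin sprob_ge0.
Qed.

Lemma le_mean f g : (forall mu, f mu <= g mu) -> mean f <= mean g.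
Proof.
move=> fg; apply: le_esum => mu _.
by rewrite lee_wpmul2l// lee_fin sprob_ge0.
Qed.

Lemma eq_mean f g : (forall mu, f mu = g mu) -> mean f = mean g.
Proof. by move=> fg; apply: eq_esum => mu _; rewrite fg. Qed.

Lemma meanD f g : (forall mu, 0 <= f mu) -> (forall mu, 0 <= g mu) ->
  mean (fun mu => f mu + g mu) = mean f + mean g.
Proof.
move=> f0 g0; rewrite /mean -esumD; last 2 first.
- by move=> mu _; rewrite mule_ge0// lee_fin sprob_ge0.
- by move=> mu _; rewrite mule_ge0// lee_fin sprob_ge0.
by apply: eq_esum => mu _; rewrite ge0_muleDr.
Qed.

Lemma mean_cst c : 0 <= c -> mean (fun=> c) = c.
Proof.
move=> c0; rewrite /mean.
have sp0 mu : 0 <= (sprob U mu)%:E by rewrite lee_fin sprob_ge0.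
case: c c0 => [r| |//] r0.
  under eq_esum do rewrite muleC.
  by rewrite ge0_esumZl// esum_sprob mule1.
(* For [c = +oo], a single sample of positive probability already makes the sum infinite. *)
have [mu sp] : exists mu, (0 < sprob U mu)%R.
  apply/not_existsP => h; have := esum_sprob; rewrite esum1; last first.
    move=> mu _; congr EFin; apply/le_anti; rewrite sprob_ge0 andbT leNgt.
    exact/negP.
  by move/eqP; rewrite eqe eq_sym oner_eq0.
apply/eqP; rewrite -leye_eq.
have e : +oo = \esum_(m in [set mu]) ((sprob U m)%:E * +oo).
  by rewrite (@esum_set1 _ _ mu (fun m => (sprob U m)%:E * +oo))//= gt0_muley.
rewrite [leLHS]e [leLHS]esum_mkcond; apply: le_esum => m _.
by case: ifP => _ //; rewrite mule_ge0.
Qed.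

Lemma mean_ereal_sup_le (f : nat -> valuation (svar W) -> \bar R) :
  (forall n mu, 0 <= f n mu) ->
  (forall mu, {homo f^~ mu : n m / (n <= m)%N >-> n <= m}) ->
  mean (fun mu => ereal_sup (range (f^~ mu))) <=
  ereal_sup (range (fun n => mean (f n))).
Proof.
move=> f0 ndf; have sp0 mu : 0 <= (sprob U mu)%:E by rewrite lee_fin sprob_ge0.
have ndg mu : {homo (fun n => (sprob U mu)%:E * f n mu) :
    n m / (n <= m)%N >-> n <= m}.
  by move=> n m nm; rewrite lee_wpmul2l// ndf.
apply: le_trans (esum_ereal_sup_le setT _ ndg).
  apply: le_esum => mu _; rewrite le_eqVlt; apply/orP; left; apply/eqP.
  have h := cvgeZl (erefl : (sprob U mu)%:E \is a fin_num)
    (ereal_nondecreasing_cvgn (ndf mu)).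
  rewrite -(cvg_lim (@ereal_hausdorff R) h).
  exact: (cvg_lim (@ereal_hausdorff R) (ereal_nondecreasing_cvgn (ndg mu))).
by move=> n mu; rewrite mule_ge0.
Qed.

Lemma push_nonterminal (e : stack_elt W) w (ne : ~~ terminal e) :
  push e w = Sub e ne :: w.
Proof. by rewrite /push insubT. Qed.

Lemma push_terminal (e : stack_elt W) w : terminal e -> push e w = w.
Proof. by move=> te; rewrite /push insubF// te. Qed.

Lemma trans_prob_ge0 (s : state W) a s' : (0 <= trans_prob U s a s')%R.
Proof. by rewrite /trans_prob; case: ifP => // _; exact: sprob_ge0. Qed.

(** Once the action is fixed, the sample determines the next state; distinct samples give distinct
    states because a state records its sample. *)
Lemma esum_trans_prob (s : state W) a (f : state W -> \bar R) : enabled s.1 a ->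
  \esum_(s' in [set: state W]) ((trans_prob U s a s')%:E * f s') =
  mean (fun mu => f (next_config s.1 a mu, mu)).
Proof.
move=> sa; pose e mu : state W := (next_config s.1 a mu, mu).
transitivity (\esum_(s' in range e) ((trans_prob U s a s')%:E * f s')).
  rewrite [RHS]esum_mkcond; apply: eq_esum => s' _; case: ifPn => //.
  rewrite notin_setE /= => h; rewrite /trans_prob sa /=.
  case: eqP => [es|_]; last by rewrite mul0e.
  by exfalso; apply: h; exists s'.2 => //; rewrite /e -es; case: (s').
rewrite esum_image; last by move=> m m' _ _ [].
by apply: eq_esum => mu _; rewrite /trans_prob sa /= eqxx.
Qed.

Section Scheduler.
Context (sigma : scheduler U).

Lemma step_prob_ge0 s0 s s' : path (possible U) s0 s ->
  (0 <= step_prob sigma s0 s s')%R.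
Proof.
by move=> ps; rewrite !addr_ge0// mulr_ge0 ?trans_prob_ge0// sched_ge0.
Qed.

Lemma step_prob_possible s0 s s' : path (possible U) s0 s ->
  step_prob sigma s0 s s' != 0%R -> path (possible U) s0 (rcons s s').
Proof.
move=> ps; rewrite rcons_path ps /=; apply: contraR.
rewrite /possible !negb_or -!leNgt => /and3P[h1 h2 h3].
have t0 a : (trans_prob U (last s0 s) a s' <= 0)%R ->
    trans_prob U (last s0 s) a s' = 0%R.
  by move=> h; apply/le_anti; rewrite h trans_prob_ge0.
by rewrite /step_prob (t0 _ h1) (t0 _ h2) (t0 _ h3) !mulr0 !addr0 eqxx.
Qed.

(** A step under [sigma] is a convex combination of steps under single actions, and disabled actions
    have weight 0. *)
Lemma esum_step_le s0 s (f : state W -> \bar R) (c : R) B :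
  path (possible U) s0 s -> (0 <= c)%R -> (forall s', 0 <= f s') -> 0 <= B ->
  (forall a, enabled (last s0 s).1 a ->
    c%:E + mean (fun mu => f (next_config (last s0 s).1 a mu, mu)) <= B) ->
  c%:E + \esum_(s' in [set: state W]) ((step_prob sigma s0 s s')%:E * f s')
    <= B.
Proof.
move=> ps c0 f0 B0 hB.
pose A a := \esum_(s' in [set: state W])
  ((trans_prob U (last s0 s) a s')%:E * f s').
have t0 a s' : 0 <= (trans_prob U (last s0 s) a s')%:E * f s'.
  by rewrite mule_ge0// lee_fin trans_prob_ge0.
have A0 a : 0 <= A a by exact: esum_ge0.
have sg a : (0 <= sigma s0 s a)%R := sched_ge0 sigma ps a.
have -> : \esum_(s' in [set: state W]) ((step_prob sigma s0 s s')%:E * f s') =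
    (sigma s0 s tau)%:E * A tau + (sigma s0 s th)%:E * A th +
    (sigma s0 s el)%:E * A el.
  have p0 a s' : 0 <= (sigma s0 s a)%:E *
      ((trans_prob U (last s0 s) a s')%:E * f s') by rewrite mule_ge0// lee_fin.
  rewrite -!ge0_esumZl// -esumD// -esumD//; last first.
    by move=> s' _; rewrite adde_ge0.
  apply: eq_esum => s' _; rewrite /step_prob !EFinD !ge0_muleDl//;
    rewrite ?lee_fin ?addr_ge0 ?mulr_ge0 ?trans_prob_ge0//.
  by rewrite !EFinM !muleA.
have term a : (sigma s0 s a)%:E * (c%:E + A a) <= (sigma s0 s a)%:E * B.
  have [ea|ea] := boolP (enabled (last s0 s).1 a).
    by rewrite lee_wpmul2l ?lee_fin// /A esum_trans_prob// hB.
  by rewrite (sched_enabled sigma ps ea) !mul0e.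
have sum1 (x : \bar R) : 0 <= x -> (sigma s0 s tau)%:E * x +
    (sigma s0 s th)%:E * x + (sigma s0 s el)%:E * x = x.
  move=> x0; rewrite -!ge0_muleDl ?adde_ge0 ?lee_fin// -!EFinD.
  by rewrite (sched_sum1 sigma ps) mul1e.
(* Since the weights sum to 1, [B] and [c] split over the three actions and [term] applies to
   each. *)
rewrite -[leRHS](sum1 _ B0) -{1}(sum1 c%:E) ?lee_fin//.
rewrite addeACA -ge0_muleDr ?lee_fin// (addeACA ((sigma s0 s tau)%:E * _)).
by rewrite -!ge0_muleDr ?lee_fin// !leeD.
Qed.

(* The expectation, given the history [s0 :: s], of the number of the next [n]
   steps that start before termination. *)
Fixpoint steps_within (n : nat) (s0 : state W) (s : seq (state W)) : \bar R :=
  if n is m.+1 then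
    if (last s0 s).1 is [::] then 0 else
    1 + \esum_(s' in [set: state W])
      ((step_prob sigma s0 s s')%:E * steps_within m s0 (rcons s s'))
  else 0.

Lemma steps_within_ge0 n s0 s : path (possible U) s0 s ->
  0 <= steps_within n s0 s.
Proof.
elim: n s => [//|n IH] s ps /=; case: (last s0 s).1 => // _ _.
rewrite adde_ge0//; apply: esum_ge0 => s' _.
(* [sigma] is constrained only on histories; an extension that is not a history has step probability
   0. *)
have [->|sn0] := eqVneq (step_prob sigma s0 s s') 0%R; first by rewrite mul0e.
by rewrite mule_ge0 ?lee_fin ?step_prob_ge0// IH// step_prob_possible.
Qed.

End Scheduler.
End Program.

(** * The expected termination time *)

Section TerminationTime.
Context {R : realType} {W : program}.
Local Open Scope ereal_scope.

(** The event [T > n]. All times up to [n] are tested, since an arbitrary sequence of states may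
    leave the empty configuration. *)
Definition running (n : nat) : set (run W) :=
  [set x | forall i, (i <= n)%N -> (x i).1 <> [::]].

Lemma cylinder_last (s0 : state W) s x : cylinder s0 s x ->
  x (size s) = last s0 s.
Proof. by move=> xs; rewrite xs// (nth_last s0 (s0 :: s)). Qed.

Lemma measurable_cylinder (s0 : state W) s :
  measurable (cylinder s0 s : set (run W)).
Proof. by apply: sub_sigma_algebra; exists s0, s. Qed.

(** The event depends on the first [n.+1] states only, and there are countably many such prefixes;
    unsuitable prefixes are sent to [set0]. *)
Lemma measurable_running n : measurable (running n).
Proof.
pose F (p : state W * seq (state W)) : set (run W) :=
  if pselect (size p.2 = n /\ forall i, (i <= n)%N ->
    (nth p.1 (p.1 :: p.2) i).1 <> [::])
  then cylinder p.1 p.2 else set0.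
rewrite (_ : running n = \bigcup_p F p); last first.
  apply/seteqP; split=> x /=.
    move=> xn; exists (x 0%N, mkseq (fun i => x i.+1) n) => //.
    have nthE i : (i <= n)%N ->
        nth (x 0%N) (x 0%N :: mkseq (fun i => x i.+1) n) i = x i.
      by case: i => //= i ni; rewrite nth_mkseq.
    rewrite /F; case: pselect => [_ i|[]]/=.
      by rewrite size_mkseq => ni; rewrite nthE.
    by rewrite size_mkseq; split=> // i ni; rewrite nthE//; exact: xn.
  move=> [[s0 s] _]; rewrite /F; case: pselect => //= -[sn sne] xs i ni.
  by rewrite xs ?sn//; exact: sne.
apply: countable_bigcupT_measurable => [|p]; first exact: countableP.
rewrite /F; case: pselect => [?|?]; last exact: measurable0.
exact: measurable_cylinder.
Qed.

Lemma term_time_series (x : run W) :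
  term_time R x = \sum_(n <oo) (\1_(running n) x)%:E.
Proof.
have ind0 n : 0 <= (\1_(running n) x : R)%:E by rewrite lee_fin.
have [xt|xnt] := pselect (exists n, (x n).1 == [::]).
  case: (ex_minnP xt) => N /eqP xN minN.
  have runN n : \1_(running n) x = (n < N)%:R :> R.
    rewrite indicE; congr (nat_of_bool _)%:R; apply/idP/idP; rewrite inE.
      by move=> xn; rewrite ltnNge; apply/negP => /xn; rewrite xN.
    move=> nN i ni /eqP xi; have := leq_trans (minN _ xi) ni.
    by rewrite leqNgt nN.
  rewrite (nneseries_split 0 N)// [X in _ + X]eseries0 ?adde0; last first.
    by move=> i Ni _; rewrite runN ltnNge Ni.
  rewrite add0n big_nat (eq_bigr (fun=> 1%:E)); last first.
    by move=> i /= iN; rewrite runN iN.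
  rewrite -big_nat sumEFin big_const_nat iter_addr_0 subn0.
  apply/le_anti/andP; split; first by apply: ereal_inf_lbound; exists N.
  apply/ereal_infP => _ [n xn <-]; rewrite lee_fin ler_nat.
  by apply: minN; apply/eqP.
have runT n : \1_(running n) x = 1%R :> R.
  rewrite indicE mem_set// => i _ xi; apply: xnt; exists i; exact/eqP.
rewrite /term_time (_ : [set _ | _ in _] = set0) ?ereal_inf0; last first.
  apply/seteqP; split=> // y [n xn _]; apply: xnt; exists n; exact/eqP.
apply/esym; apply: eq_infty => r.
apply: le_trans (nneseries_lim_ge (Num.trunc r).+1 _) => //.
rewrite (eq_bigr (fun=> 1%:E)); last by move=> i _; rewrite runT.
rewrite sumEFin big_const_nat iter_addr_0 subn0 lee_fin ltW//.
exact: truncnS_gt.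
Qed.

(** Tail-sum formula for the expectation, by integrating [term_time_series] term by term. *)
Lemma integral_term_time (P : {measure set (run W) -> \bar R}) :
  \int[P]_x term_time R x = \sum_(n <oo) P (running n).
Proof.
under eq_integral do rewrite term_time_series.
rewrite integral_nneseries//; last first.
  move=> n; apply/measurable_EFinP; apply: measurable_indic.
  exact: measurable_running.
apply: eq_eseriesr => n _; rewrite integral_indic ?setIT//.
exact: measurable_running.
Qed.

Context {U : sampling W R} (sigma : scheduler U).

Lemma path_prob_rcons s0 s s' :
  path_prob sigma s0 (rcons s s') =
  (path_prob sigma s0 s * step_prob sigma s0 s s')%R.
Proof.
pose F s i := step_prob sigma s0 (take i s) (nth s0 s i).
have E t : path_prob sigma s0 t = (\prod_(0 <= i < size t) F t i)%R.
  by rewrite big_mkord.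
rewrite !E size_rcons big_nat_recr//=; congr (_ * _)%R.
  rewrite !big_nat; apply: eq_bigr => i /= si; rewrite /F nth_rcons si.
  by rewrite -cats1 take_cat si.
by rewrite /F nth_rcons ltnn eqxx -cats1 take_size_cat.
Qed.

Lemma cylinder_rcons (s0 : state W) s :
  cylinder s0 s = \bigcup_s' cylinder s0 (rcons s s').
Proof.
apply/seteqP; split=> x /=.
  move=> xs; exists (x (size s).+1) => // i.
  rewrite size_rcons leq_eqVlt ltnS => /predU1P[->|si].
    by rewrite /= nth_rcons ltnn eqxx.
  by rewrite -rcons_cons nth_rcons /= ltnS si xs.
move=> [s' _ xs] i si; rewrite xs; last by rewrite size_rcons leqW.
by rewrite -rcons_cons nth_rcons /= ltnS si.
Qed.

Lemma trivIset_cylinder_rcons (s0 : state W) s :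
  trivIset [set: state W] (fun s' => cylinder s0 (rcons s s')).
Proof.
apply/trivIsetP => a b _ _ /eqP ab; apply/seteqP; split=> x //= -[].
move=> /(_ (size s).+1); rewrite size_rcons leqnn => /(_ isT) xa.
move=> /(_ (size s).+1); rewrite size_rcons leqnn => /(_ isT) xb.
by apply: ab; move: xa; rewrite xb /= !nth_rcons ltnn eqxx.
Qed.

Context (c : stack_elt W) (P : probability (run W) R).
Hypothesis Pc : induced sigma c P.

(** Identifies [steps_within] as a conditional expectation, in product form so that null cylinders
    need no division. The cylinder is split according to the next state. *)
Lemma induced_running n s0 s : path (possible U) s0 s ->
  (forall i, (i < size s)%N -> (nth s0 (s0 :: s) i).1 <> [::]) ->
  \sum_(k < n) P (cylinder s0 s `&` running (size s + k)) =
  P (cylinder s0 s) * steps_within sigma n s0 s.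
Proof.
elim: n s => [|n IH] s ps sne /=; first by rewrite big_ord0 mule0.
case lastC : (last s0 s).1 => [|d w].
  rewrite mule0 big1// => k _.
  rewrite [X in P X](_ : _ = set0) ?measure0//; apply/seteqP; split=> x //= -[xs].
  by move=> /(_ (size s) (leq_addr _ _)); rewrite (cylinder_last xs) lastC.
have P0 : P (cylinder s0 s) = (fine (P (cylinder s0 s)))%:E by rewrite Pc.
have P0_ge0 : (0 <= fine (P (cylinder s0 s)))%R by rewrite fine_ge0.
have J0 s' : 0 <= (step_prob sigma s0 s s')%:E *
    steps_within sigma n s0 (rcons s s').
  have [->|sn0] := eqVneq (step_prob sigma s0 s s') 0%R; first by rewrite mul0e.
  by rewrite mule_ge0 ?lee_fin ?step_prob_ge0// steps_within_ge0//
    (step_prob_possible ps sn0).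
(* The term [k = 0] is the whole cylinder, all of whose configurations are nonempty; it accounts for
   the summand 1. *)
rewrite big_ord_recl addn0 ge0_muleDr ?esum_ge0// mule1; congr (_ + _).
  congr (P _); apply/setIidPl => x xs i; rewrite leq_eqVlt => /predU1P[->|si].
    by rewrite (cylinder_last xs) lastC.
  by rewrite xs ?(ltnW si)//; exact: sne.
transitivity (\sum_(k < n) \esum_(s' in [set: state W])
    P (cylinder s0 (rcons s s') `&` running (size (rcons s s') + k))).
  apply: eq_bigr => k _; rewrite {1}cylinder_rcons setI_bigcupl measure_esum.
  - by apply: eq_esum => s' _; rewrite size_rcons addSnnS.
  - move=> s'; apply: measurableI; last exact: measurable_running.
    exact: measurable_cylinder.
  - by apply: trivIset_setIr; exact: trivIset_cylinder_rcons.
rewrite -esum_sum// P0 -ge0_esumZl//; apply: eq_esum => s' _.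
have [st0|sn0] := eqVneq (step_prob sigma s0 s s') 0%R.
  have Pr0 : P (cylinder s0 (rcons s s')) = 0.
    by rewrite Pc path_prob_rcons st0 mulr0 if_same.
  rewrite st0 mul0e mule0 big1// => k _.
  apply/eqP; rewrite -measure_le0 -Pr0 measureIl//.
  - exact: measurable_cylinder.
  - exact: measurable_running.
rewrite IH; last 2 first.
- exact: step_prob_possible sn0.
- move=> i; rewrite size_rcons ltnS leq_eqVlt => /predU1P[->|si].
    by rewrite -rcons_cons nth_rcons /= ltnSn (nth_last s0 (s0 :: s)) /= lastC.
  by rewrite -rcons_cons nth_rcons /= ltnS (ltnW si); exact: sne.
rewrite muleA; congr (_ * _); rewrite -P0 !Pc path_prob_rcons.
by case: ifP => // _; rewrite mul0e.
Qed.

Lemma running_steps_within n :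
  \sum_(0 <= k < n) P (running k) = steps_within sigma n (init c) [::].
Proof.
have P1 : P (cylinder (init c) [::]) = 1 by rewrite Pc eqxx /path_prob big_ord0.
have := @induced_running n (init c) [::] erefl.
rewrite P1 mul1e => <-//; rewrite big_mkord; apply: eq_bigr => k _ /=.
have mC := measurable_cylinder (init c) [::].
have mA := measurable_running k.
(* Runs that do not start in [init c] form a null set. *)
rewrite add0n setIC (measureDI P mA mC) -[RHS]add0e; congr (_ + _).
apply/eqP; rewrite -measure_le0 (_ : 0 = P (~` cylinder (init c) [::])).
  by rewrite le_measure ?inE//; [exact: measurableD|exact: measurableC].
by rewrite probability_setC// P1 subee.
Qed.

End TerminationTime.

(** * Soundness *)

Section Soundness.
Context {R : realType} {W : program} {U : sampling W R}.
Local Open Scope ereal_scope.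
Implicit Types (w : config W) (a : action).
Context (h : stack_elt W -> \bar R) (eps : R).
Hypothesis h0 : forall e, 0 <= h e.
Hypothesis eps0 : (0 < eps)%R.
Hypothesis h_terminal : forall e, terminal e -> h e = 0.
Hypothesis h_step : forall (f : fname W) (l : label f) (nu : valuation (pvar f)),
  l <> lout f ->
  match code l with
  | Assign u l' => eps%:E + mean U (fun mu => h (elt l' (u nu mu))) <= h (elt l nu)
  | Call g v l' => eps%:E + h (elt (lin g) (v nu)) + h (elt l' nu) <= h (elt l nu)
  | Branch phi l1 l2 =>
      h (elt (if satisfies nu phi then l1 else l2) nu) + eps%:E <= h (elt l nu)
  | Nondet l1 l2 => maxe (h (elt l1 nu)) (h (elt l2 nu)) + eps%:E <= h (elt l nu)
  end.

Definition stack_rank w : \bar R := \sum_(d <- w) h (\val d).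

Lemma stack_rank_ge0 w : 0 <= stack_rank w.
Proof. by apply: sume_ge0. Qed.

(** By (C1) the terminal elements that [push] discards have rank 0. *)
Lemma stack_rank_push e w : stack_rank (push e w) = h e + stack_rank w.
Proof.
have [te|ne] := boolP (terminal e).
  by rewrite push_terminal// h_terminal// add0e.
by rewrite push_nonterminal /stack_rank big_cons.
Qed.

(** The letters of [w] contribute a constant, so (C2)-(C5) for the top letter carry over to the
    stack; the two letters created by a call are the two summands of (C3). *)
Lemma stack_rank_step d w a :
  eps%:E + mean U (fun mu => stack_rank (next_config (d :: w) a mu)) <=
  stack_rank (d :: w).
Proof.
rewrite {2}/stack_rank big_cons -/(stack_rank w).
case: d => -[f [l nu]] /= ne.
have /h_step : l <> lout f by apply/eqP.
move=> /(_ nu); rewrite -[existT _ f (l, nu)]/(elt l nu).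
have H0 := stack_rank_ge0 w.
case: (code l) => [u l'|g v l'|phi l1 l2|l1 l2] hl.
- under eq_mean do rewrite stack_rank_push.
  by rewrite meanD// mean_cst// addeA leeD.
- under eq_mean do rewrite !stack_rank_push.
  by rewrite mean_cst ?adde_ge0// !addeA leeD.
- under eq_mean do rewrite !stack_rank_push.
  by rewrite mean_cst ?adde_ge0// addeA leeD// addeC.
- under eq_mean do rewrite !stack_rank_push.
  rewrite mean_cst ?adde_ge0// addeA leeD//; apply: le_trans hl.
  by rewrite addeC leeD// le_max; case: a; rewrite lexx ?orbT.
Qed.

(** Supermartingale argument: each step before termination costs [eps], which is covered by the mean
    decrease of [stack_rank] under any action. *)
Lemma steps_within_le_rank (sigma : scheduler U) n s0 s :
  path (possible U) s0 s ->
  eps%:E * steps_within sigma n s0 s <= stack_rank (last s0 s).1.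
Proof.
elim: n s => [|n IH] s ps /=; first by rewrite mule0 stack_rank_ge0.
case lastC : (last s0 s).1 => [|d w]; first by rewrite mule0 stack_rank_ge0.
have J0 s' : 0 <= (step_prob sigma s0 s s')%:E *
    steps_within sigma n s0 (rcons s s').
  have [->|sn0] := eqVneq (step_prob sigma s0 s s') 0%R; first by rewrite mul0e.
  by rewrite mule_ge0 ?lee_fin ?step_prob_ge0// steps_within_ge0//
    (step_prob_possible ps sn0).
rewrite ge0_muleDr ?esum_ge0// mule1 -ge0_esumZl ?(ltW eps0)//.
apply: (@le_trans _ _ (eps%:E + \esum_(s' in [set: state W])
    ((step_prob sigma s0 s s')%:E * stack_rank s'.1))).
  rewrite leeD2l//; apply: le_esum => s' _.
  have [->|sn0] := eqVneq (step_prob sigma s0 s s') 0%R.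
    by rewrite !mul0e mule0.
  rewrite muleCA lee_wpmul2l ?lee_fin ?step_prob_ge0//.
  by have := IH _ (step_prob_possible ps sn0); rewrite last_rcons.
apply: esum_step_le => //; first exact: ltW.
- by move=> s'; exact: stack_rank_ge0.
- exact: stack_rank_ge0.
- by move=> a _; rewrite lastC; exact: stack_rank_step.
Qed.

Lemma Tbar_le_rank c : ~~ terminal c -> Tbar U c <= (eps^-1)%:E * h c.
Proof.
move=> nc; rewrite /Tbar (negbTE nc); apply: ge_ereal_sup.
move=> _ [sigma [P [Pc ->]]].
rewrite integral_term_time; apply: lime_le.
  by apply: is_cvg_nneseries.
apply: nearW => n; rewrite (running_steps_within Pc).
have := @steps_within_le_rank sigma n (init c) [::] erefl.
rewrite /= stack_rank_push /stack_rank big_nil adde0 => hn.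
rewrite -[leLHS]mul1e -(mulVf (lt0r_neq0 eps0)) EFinM -muleA.
by rewrite lee_wpmul2l// lee_fin invr_ge0 ltW.
Qed.

End Soundness.

(** * Completeness *)

Section Completeness.
Context {R : realType} {W : program} (U : sampling W R).
Local Open Scope ereal_scope.
Implicit Types (e : stack_elt W) (w : config W) (a : action).

Lemma next_config_push f (l : label f) nu w a mu : l != lout f ->
  next_config (push (elt l nu) w) a mu =
  match code l with
  | Assign u l' => push (elt l' (u nu mu)) w
  | Call g v l' => push (elt (lin g) (v nu)) (push (elt l' nu) w)
  | Branch phi l1 l2 => push (elt (if satisfies nu phi then l1 else l2) nu) w
  | Nondet l1 l2 => push (elt (if a is el then l2 else l1) nu) w
  end.
Proof. by move=> nl; rewrite (@push_nonterminal _ (elt l nu)). Qed.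

(** Shows that a step of the top letter leaves [w] intact below, so that [horizon_push_ge] can be
    iterated. *)
Lemma next_config_cons d w a mu : exists s,
  next_config (d :: w) a mu = foldr (@push W) w s.
Proof.
case: d => -[f [l nu]] ne; rewrite -[_ :: w](push_nonterminal w ne).
rewrite -[existT _ f (l, nu)]/(elt l nu) next_config_push//.
case: (code l) => [u l'|g v l'|phi l1 l2|l1 l2].
- by exists [:: elt l' (u nu mu)].
- by exists [:: elt (lin g) (v nu); elt l' nu].
- by exists [:: elt (if satisfies nu phi then l1 else l2) nu].
- by exists [:: elt (if a is el then l2 else l1) nu].
Qed.

(** Justifies that [horizon] compares [th] and [el] even where only [tau] is enabled. *)
Lemma next_config_det w a b mu : ~~ is_nondet w ->
  next_config w a mu = next_config w b mu.
Proof.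
case: w => [//|[[f [l nu]] ne] w] /=.
by case: (code l).
Qed.

(* The largest expectation of [min T n] from the configuration [w]. *)
Fixpoint horizon (n : nat) w : \bar R :=
  if n is m.+1 then
    if w is [::] then 0 else
    1 + maxe (mean U (fun mu => horizon m (next_config w th mu)))
             (mean U (fun mu => horizon m (next_config w el mu)))
  else 0.

Lemma horizon_ge0 n w : 0 <= horizon n w.
Proof.
elim: n w => [//|n IH] [|d w] //=.
by rewrite adde_ge0// le_max mean_ge0.
Qed.

Lemma horizon_step n d w a :
  1 + mean U (fun mu => horizon n (next_config (d :: w) a mu)) <=
  horizon n.+1 (d :: w).
Proof.
by rewrite leeD2l// le_max; case: a; rewrite ?lexx ?orbT.
Qed.

Lemma horizonS_le n w : horizon n w <= horizon n.+1 w.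
Proof.
elim: n w => [|n IH] w; first exact: horizon_ge0.
case: w => [//|d w]; rewrite [leLHS]/= [leRHS]/= leeD2l//.
rewrite ge_max !le_max; apply/andP.
by split; apply/orP; [left|right]; apply: le_mean => mu; exact: IH.
Qed.

Lemma horizon_nd w : {homo horizon^~ w : n m / (n <= m)%N >-> n <= m}.
Proof. by apply: homo_leq => [|? ? ?|n]; [|exact: le_trans|exact: horizonS_le]. Qed.

(** Reflects [min(T, n+1) <= 1 + min(T, n)]; it pays for the step made by the added letter in
    [horizon_push_ge]. *)
Lemma horizonS_le1 n w : horizon n.+1 w <= 1 + horizon n w.
Proof.
elim: n w => [|n IH] [|d w]; [by rewrite adde_ge0| |by rewrite adde_ge0|].
  by rewrite /= mean_cst// maxxx.
rewrite [leLHS]/= leeD2l// ge_max.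
have step a : mean U (fun mu => horizon n.+1 (next_config (d :: w) a mu)) <=
    horizon n.+1 (d :: w).
  apply: le_trans (horizon_step n d w a).
  rewrite -[X in X + _](@mean_cst _ _ U 1)// -meanD//.
    by apply: le_mean => mu; exact: IH.
  by move=> mu; exact: horizon_ge0.
by apply/andP; split; [exact: step th|exact: step el].
Qed.

Lemma horizon_push_ge n e w : horizon n w <= horizon n (push e w).
Proof.
elim: n e w => [//|n IH] e w.
have [te|ne] := boolP (terminal e); first by rewrite push_terminal.
(* Any action would do: after one step [w] still lies at the bottom, and the induction hypothesis
   removes the letters above it. *)
rewrite push_nonterminal; apply: le_trans (horizon_step n _ _ th).
apply: le_trans (horizonS_le1 n w) _; rewrite leeD2l//.
rewrite -[leLHS](mean_cst U (horizon_ge0 n w)); apply: le_mean => mu.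
have [s ->] := next_config_cons (Sub e ne) w th mu.
by elim: s => //= e' s /le_trans; apply; exact: IH.
Qed.

Definition value w : \bar R := ereal_sup (range (horizon^~ w)).

Lemma horizon_le_value n w : horizon n w <= value w.
Proof. by apply: ereal_sup_ubound; exists n. Qed.

Lemma value_ge0 w : 0 <= value w.
Proof. exact: le_trans (horizon_ge0 0 w) (horizon_le_value 0 w). Qed.

Lemma value_push_ge e w : value w <= value (push e w).
Proof.
apply: ge_ereal_sup => _ [n _ <-]; apply: le_trans (horizon_push_ge n e w) _.
exact: horizon_le_value.
Qed.

(** The limit of [horizon_step], by monotone convergence under [mean]. *)
Lemma value_step d w a :
  1 + mean U (fun mu => value (next_config (d :: w) a mu)) <= value (d :: w).
Proof.
pose v n mu := horizon n (next_config (d :: w) a mu).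
have v0 n mu : 0 <= v n mu by exact: horizon_ge0.
have ndv mu : {homo v^~ mu : n m / (n <= m)%N >-> n <= m}.
  by move=> n m nm; exact: horizon_nd.
apply: (@le_trans _ _ (1 + ereal_sup (range (fun n => mean U (v n))))).
  by apply: leeD2l; exact: mean_ereal_sup_le.
rewrite addel_ereal_sup//.
- apply: ge_ereal_sup => _ [n _ <-].
  exact: le_trans (horizon_step n d w a) (horizon_le_value _ _).
- by move=> n; exact: mean_ge0.
- by move=> n m nm; apply: le_mean => mu; exact: ndv.
Qed.

(* The iterates, starting from [0], of the operator whose fixed points satisfy
   (C1)-(C5) with equality for [eps = 1]. *)
Fixpoint rank_iter (n : nat) e : \bar R :=
  if n is m.+1 then
    let: existT f (l, nu) := e in
    if l == lout f then 0 else
    1 + match code l with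
        | Assign u l' => mean U (fun mu => rank_iter m (elt l' (u nu mu)))
        | Call g v l' => rank_iter m (elt (lin g) (v nu)) + rank_iter m (elt l' nu)
        | Branch phi l1 l2 =>
            rank_iter m (elt (if satisfies nu phi then l1 else l2) nu)
        | Nondet l1 l2 => maxe (rank_iter m (elt l1 nu)) (rank_iter m (elt l2 nu))
        end
  else 0.

Lemma rank_iterS n (f : fname W) (l : label f) nu : l != lout f ->
  rank_iter n.+1 (elt l nu) =
  1 + match code l with
      | Assign u l' => mean U (fun mu => rank_iter n (elt l' (u nu mu)))
      | Call g v l' => rank_iter n (elt (lin g) (v nu)) + rank_iter n (elt l' nu)
      | Branch phi l1 l2 =>
          rank_iter n (elt (if satisfies nu phi then l1 else l2) nu)
      | Nondet l1 l2 => maxe (rank_iter n (elt l1 nu)) (rank_iter n (elt l2 nu))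
      end.
Proof. exact: ifN. Qed.

Lemma rank_iter_ge0 n e : 0 <= rank_iter n e.
Proof.
elim: n e => [//|n IH] [f [l nu]] /=; case: ifP => // _.
rewrite adde_ge0//; case: (code l) => [u l'|g v l'|phi l1 l2|l1 l2] //.
- exact: mean_ge0.
- exact: adde_ge0.
- by rewrite le_max IH.
Qed.

Lemma rank_iter_nd e : {homo rank_iter^~ e : n m / (n <= m)%N >-> n <= m}.
Proof.
apply: homo_leq => [|? ? ?|n]; [by []|exact: le_trans|].
elim: n e => [|n IH] e; first exact: rank_iter_ge0.
case: e => [f [l nu]]; rewrite [leLHS]/= [leRHS]/=; case: ifP => // _.
rewrite leeD2l//; case: (code l) => [u l'|g v l'|phi l1 l2|l1 l2] //.
- exact: le_mean.
- exact: leeD.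
- by rewrite ge_max !le_max !IH ?orbT.
Qed.

(* Executing [e] first only postpones the steps counted by [value w]. *)
Lemma rank_iter_value n e w : rank_iter n e + value w <= value (push e w).
Proof.
elim: n e w => [|n IH] e w; first by rewrite add0e value_push_ge.
case: e => [f [l nu]] /=; case: ifPn => [te|ne].
  by rewrite add0e push_terminal.
rewrite -[existT _ f (l, nu)]/(elt l nu).
have V a : 1 + mean U (fun mu => value
    (next_config (push (elt l nu) w) a mu)) <= value (push (elt l nu) w).
  by rewrite (@push_nonterminal _ (elt l nu) w ne); exact: value_step.
have v0 := value_ge0.
rewrite -addeA; case E : (code l) V => [u l'|g v l'|phi l1 l2|l1 l2] V.
- apply: le_trans (V tau); rewrite leeD2l//.
  rewrite -[X in _ + X](mean_cst U (v0 w)) -meanD//; last first.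
    by move=> mu; exact: rank_iter_ge0.
  by apply: le_mean => mu; rewrite next_config_push// E.
- apply: le_trans (V tau); rewrite leeD2l//.
  under eq_mean do rewrite next_config_push// E.
  (* The induction hypothesis is used twice: for the callee above the return letter, then for the
     return letter above [w]. *)
  rewrite mean_cst// -addeA; apply: le_trans (IH _ _).
  by rewrite leeD2l.
- apply: le_trans (V tau); rewrite leeD2l//.
  under eq_mean do rewrite next_config_push// E.
  by rewrite mean_cst.
(* The action is the one that leads to the branch of larger rank. *)
- rewrite maxEle; case: ifP => _.
    apply: le_trans (V el); rewrite leeD2l//.
    under eq_mean do rewrite next_config_push// E.
    by rewrite mean_cst.
  apply: le_trans (V th); rewrite leeD2l//.
  under eq_mean do rewrite next_config_push// E.
  by rewrite mean_cst.
Qed.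

Definition least_rank e : \bar R := ereal_sup (range (rank_iter^~ e)).

Lemma rank_iter_le n e : rank_iter n e <= least_rank e.
Proof. by apply: ereal_sup_ubound; exists n. Qed.

Lemma least_rank_ge0 e : 0 <= least_rank e.
Proof. exact: le_trans (rank_iter_ge0 0 e) (rank_iter_le 0 e). Qed.

Lemma ranking_least_rank : ranking U least_rank.
Proof.
split; first exact: least_rank_ge0.
exists 1%R; split=> // f l nu; split=> [->|/eqP nl].
  apply/le_anti; rewrite least_rank_ge0 andbT.
  by apply: ge_ereal_sup => _ [[|n] _ <-] //=; rewrite eqxx.
(* Here [r n] stands for the rank that remains after one step, computed from the [n]-th iterate. *)
have sup_step (r : nat -> \bar R) : (forall n, 0 <= r n) ->
    {homo r : n m / (n <= m)%N >-> n <= m} ->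
    (forall n, rank_iter n.+1 (elt l nu) = 1 + r n) ->
    1%:E + ereal_sup (range r) <= least_rank (elt l nu).
  move=> r0 ndr rE.
  rewrite addel_ereal_sup//; apply: ge_ereal_sup => _ [n _ <-].
  by rewrite -rE rank_iter_le.
have stepE n := rank_iterS n nu nl.
case E : (code l) stepE => [u l'|g v l'|phi l1 l2|l1 l2] stepE.
- rewrite mean_supp.
  apply: le_trans (sup_step _ _ _ stepE).
  + rewrite leeD2l//; apply: mean_ereal_sup_le => [n mu|mu].
      exact: rank_iter_ge0.
    exact: rank_iter_nd.
  + by move=> n; apply: mean_ge0 => mu; exact: rank_iter_ge0.
  + by move=> n m nm; apply: le_mean => mu; exact: rank_iter_nd.
- rewrite -addeA adde_ereal_sup; try exact: rank_iter_nd.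
  + apply: sup_step stepE => [n|n m nm]; first by rewrite adde_ge0// rank_iter_ge0.
    by apply: leeD; exact: rank_iter_nd.
  + by move=> n; exact: rank_iter_ge0.
  + by move=> n; exact: rank_iter_ge0.
(* The zero indicator removes the branch not taken, even if its rank is infinite. *)
- rewrite addeC; case: (satisfies nu phi) stepE => stepE /=;
    rewrite mul0e mul1e ?adde0 ?add0e;
    apply: sup_step stepE => [n|]; by [exact: rank_iter_ge0|exact: rank_iter_nd].
- rewrite addeC.
  (* The maximum of two suprema is one of them, so each branch is bounded separately. *)
  have sup_le l' : (forall n, rank_iter n (elt l' nu) <=
      maxe (rank_iter n (elt l1 nu)) (rank_iter n (elt l2 nu))) ->
      1%:E + least_rank (elt l' nu) <= least_rank (elt l nu).
    move=> le_l'; apply: le_trans (sup_step _ _ _ stepE).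
    + rewrite leeD2l//; apply: ge_ereal_sup => _ [n _ <-].
      by apply: le_trans (le_l' n) _; apply: ereal_sup_ubound; exists n.
    + by move=> n; rewrite le_max rank_iter_ge0.
    + by move=> n m nm; rewrite ge_max !le_max !(rank_iter_nd _ nm) orbT.
  by rewrite maxEle; case: ifP => _; apply: sup_le => n; rewrite le_max lexx ?orbT.
Qed.

Lemma least_rank_le_value c : least_rank c <= value (push c [::]).
Proof.
apply: ge_ereal_sup => _ [n _ <-]; apply: le_trans (rank_iter_value n c [::]).
by rewrite leeDl// value_ge0.
Qed.

End Completeness.

(** * Greedy schedulers *)

Section DeterministicScheduler.
Context {R : realType} {W : program} (U : sampling W R).
Context (act : nat -> config W -> action).
Hypothesis act_enabled : forall n w, enabled w (act n w).

Definition action_ind (a b : action) : R := `[< a = b >]%:R.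

Lemma action_ind_refl a : action_ind a a = 1.
Proof. by rewrite /action_ind asboolT. Qed.

Lemma action_ind_neq a b : a <> b -> action_ind a b = 0.
Proof. by move=> ab; rewrite /action_ind asboolF. Qed.

Definition det_sched_fun (s0 : state W) (s : seq (state W)) (a : action) : R :=
  action_ind (act (size s) (last s0 s).1) a.

Lemma det_sched_ge0 s0 s : path (possible U) s0 s ->
  forall a, 0 <= det_sched_fun s0 s a.
Proof. by move=> _ a; exact: ler0n. Qed.

Lemma det_sched_enabled s0 s : path (possible U) s0 s ->
  forall a, ~~ enabled (last s0 s).1 a -> det_sched_fun s0 s a = 0.
Proof.
move=> _ a na; apply: action_ind_neq => aE; move: na.
by rewrite -aE act_enabled.
Qed.

Lemma det_sched_sum1 s0 s : path (possible U) s0 s ->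
  det_sched_fun s0 s tau + det_sched_fun s0 s th + det_sched_fun s0 s el = 1.
Proof.
move=> _; rewrite /det_sched_fun; case: (act _ _);
  by rewrite action_ind_refl !action_ind_neq// ?addr0 ?add0r.
Qed.

Definition det_sched : scheduler U :=
  Scheduler det_sched_ge0 det_sched_enabled det_sched_sum1.

Lemma step_prob_det s0 s s' :
  step_prob det_sched s0 s s' =
  trans_prob U (last s0 s) (act (size s) (last s0 s).1) s'.
Proof.
rewrite /step_prob /= /det_sched_fun; case: (act _ _);
  by rewrite action_ind_refl !action_ind_neq// ?mul0r ?mul1r ?addr0 ?add0r.
Qed.

Context (c : stack_elt W).

(** With deterministic actions the samples are the only randomness, so the run is a function of
    them; [x m] is drawn in the step from time [m] to [m.+1]. *)
Fixpoint det_run (x : nat -> valuation (svar W)) (n : nat) : state W :=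
  if n is m.+1 then
    let w := (det_run x m).1 in (next_config w (act m w) (x m), x m)
  else init c.

Lemma det_run_eq x y n : (forall i, (i < n)%N -> x i = y i) ->
  det_run x n = det_run y n.
Proof.
elim: n => [//|n IH] xy /=; rewrite (xy n)//.
by rewrite IH// => i ni; apply: xy; rewrite ltnW.
Qed.

(** The states record the samples, so following [s] fixes the first [size s] samples; conversely
    these determine the states. *)
Lemma det_run_cylinder x s :
  cylinder (init c) s (det_run x) ->
  det_run @^-1` cylinder (init c) s = seq_cylinder [ffun=> 0] (map snd s).
Proof.
move=> xs; have sE y : cylinder (init c) s (det_run y) ->
    forall i, (i < size s)%N -> y i = (nth (init c) s i).2.
  by move=> ys i si; have := ys i.+1 si => /= <-.
apply/seteqP; split=> y /= ys i.
  rewrite size_map => si; rewrite (nth_map (init c))//; exact: sE.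
move=> si; rewrite -xs//; apply: det_run_eq => j ji.
have js := leq_trans ji si; rewrite (sE x xs)// ys ?size_map//.
by rewrite (nth_map (init c)).
Qed.

(** Contrapositively, a cylinder that no [det_run] meets has path probability 0, as [induced]
    requires. *)
Lemma det_run_consistent s :
  path_prob det_sched (init c) s != 0 ->
  exists x, cylinder (init c) s (det_run x).
Proof.
elim/last_ind: s => [_|s s' IH]; first by exists (fun=> [ffun=> 0]) => -[].
rewrite path_prob_rcons mulf_eq0 negb_or => /andP[/IH[x xs]].
rewrite step_prob_det /trans_prob act_enabled /=.
case: (s'.1 =P _) => [s'E _|_ /eqP//].
(* Changing the sample at index [size s] leaves the states up to time [size s] unchanged. *)
pose y i := if i == size s then s'.2 else x i.
exists y => i; rewrite size_rcons leq_eqVlt => /predU1P[->|si].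
  have ys : y (size s) = s'.2 by rewrite /y eqxx.
  rewrite /= nth_rcons ltnn eqxx ys.
  rewrite (_ : det_run y (size s) = last (init c) s).
    by rewrite -s'E; case: (s').
  rewrite (@det_run_eq y x) => [|j js]; last by rewrite /y ltn_eqF.
  exact: cylinder_last.
rewrite -rcons_cons nth_rcons /= si (@det_run_eq y x) ?xs// => j ji.
by rewrite /y ltn_eqF// (leq_trans ji).
Qed.

Lemma path_prob_det x s : cylinder (init c) s (det_run x) ->
  path_prob det_sched (init c) s = weight (sprob U) (map snd s).
Proof.
elim/last_ind: s => [_|s s' IH xs]; first by rewrite /path_prob big_ord0
  /weight big_nil.
have xs' : cylinder (init c) s (det_run x).
  by rewrite cylinder_rcons; exists s'.
rewrite path_prob_rcons IH// map_rcons /weight -cats1 big_cat big_seq1 /=.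
congr (_ * _); rewrite step_prob_det /trans_prob act_enabled.
have := xs (size s).+1; rewrite size_rcons leqnn /= nth_rcons ltnn eqxx.
move=> /(_ isT) <- /=.
by rewrite (cylinder_last xs') eqxx.
Qed.

Lemma induced_det : exists P : probability (run W) R, induced det_sched c P.
Proof.
have [|P PE] := iid_distribution (sprob_ge0 U) (esum_sprob U)
  (t0 := [ffun=> 0]) (rho := det_run : _ -> run W) erefl.
  move=> _ [s0 [s ->]].
  have [[x xs]|ns] := pselect (exists x, cylinder s0 s (det_run x)).
    have s0E : s0 = init c by have := xs 0%N isT => /= <-.
    by right; exists (map snd s); move: xs; rewrite s0E; exact: det_run_cylinder.
  by left; apply/seteqP; split=> // x xs; apply: ns; exists x.
exists P => s0 s; have [P0 Pw] := PE (cylinder s0 s).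
have [[x xs]|ns] := pselect (exists x, cylinder s0 s (det_run x)).
  have s0E : s0 = init c by have := xs 0%N isT => /= <-.
  move: xs Pw; rewrite s0E eqxx => xs Pw.
  by rewrite (path_prob_det xs); apply: Pw; exact: det_run_cylinder xs.
rewrite P0; last by apply/seteqP; split=> // x xs; apply: ns; exists x.
case: eqP => // s0E; congr EFin; apply/esym/eqP; apply: contra_notT ns => pn0.
by move: pn0; rewrite s0E; exact: det_run_consistent.
Qed.

End DeterministicScheduler.

Section Greedy.
Context {R : realType} {W : program} (U : sampling W R).
Local Open Scope ereal_scope.

(** For horizon [N], exactly [N - n.+1] steps remain after the one taken at time [n]; the action
    maximises their value. *)
Definition greedy (N n : nat) (w : config W) : action :=
  let best a := mean U (fun mu => horizon U (N - n.+1) (next_config w a mu)) in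
  if ~~ is_nondet w then tau else if best th < best el then el else th.

Lemma greedy_enabled N n w : enabled w (greedy N n w).
Proof.
rewrite /greedy; case: ifPn => [//|]; rewrite negbK => nd.
by case: ifP.
Qed.

Lemma mean_greedy N n w :
  mean U (fun mu => horizon U (N - n.+1) (next_config w (greedy N n w) mu)) =
  maxe (mean U (fun mu => horizon U (N - n.+1) (next_config w th mu)))
       (mean U (fun mu => horizon U (N - n.+1) (next_config w el mu))).
Proof.
rewrite /greedy; case: ifPn => [nd|_]; last first.
  by rewrite /Order.max; case: ifP.
have e a b : mean U (fun mu => horizon U (N - n.+1) (next_config w a mu)) =
    mean U (fun mu => horizon U (N - n.+1) (next_config w b mu)).
  by apply: eq_mean => mu; rewrite (next_config_det a b).
by rewrite (e tau th) (e el th) maxxx.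
Qed.

(** Elapsed time plus remaining horizon stays equal to [N], so the greedy choice at each history
    attains the maximum in [horizon]. *)
Lemma steps_within_greedy N n s0 s : (size s + n)%N = N ->
  steps_within (det_sched U (greedy_enabled N)) n s0 s =
  horizon U n (last s0 s).1.
Proof.
elim: n s => [//|n IH] s sN /=; case lastC : (last s0 s).1 => [//|d w].
have nE : (N - (size s).+1)%N = n by rewrite -sN addnS subSS addKn.
have := mean_greedy N (size s) (d :: w); rewrite nE -lastC => <-; congr (_ + _).
rewrite -(@esum_trans_prob _ _ U _ _ (fun s' => horizon U n s'.1)
  (greedy_enabled N (size s) (last s0 s).1)); apply: eq_esum => s' _.
by rewrite step_prob_det IH ?last_rcons// size_rcons addSnnS.
Qed.

(** Each horizon has its own greedy scheduler, which is enough because [Tbar] is a supremum over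
    schedulers; truncation only lowers the expectation. *)
Lemma value_le_Tbar c : ~~ terminal c -> value U (push c [::]) <= Tbar U c.
Proof.
move=> nc; apply: ge_ereal_sup => _ [n _ <-]; rewrite /Tbar (negbTE nc).
have [P Pc] := induced_det U (greedy_enabled n) c.
apply: (@le_trans _ _ (\int[P]_w term_time R w)); last first.
  by apply: ereal_sup_ubound; exists (det_sched U (greedy_enabled n)), P.
rewrite integral_term_time.
have := running_steps_within Pc n.
rewrite (@steps_within_greedy n n _ [::])// => <-.
exact: nneseries_lim_ge.
Qed.

End Greedy.

Theorem theorem1 (R : realType) (W : program) (U : sampling W R)
    (c : stack_elt W) (hc : ~~ terminal c) :
  boundedly_terminating U c <->
  exists h : stack_elt W -> \bar R, ranking U h /\ (h c < +oo)%E.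
Proof.
split=> [bt|[h [[h0 [eps [eps0 hr]]] hfin]]].
  exists (least_rank U); split; first exact: ranking_least_rank.
  apply: le_lt_trans bt; apply: le_trans (value_le_Tbar U hc).
  exact: least_rank_le_value.
have : (Tbar U c <= (eps^-1)%:E * h c)%E.
  apply: Tbar_le_rank => // [[f [l nu]] /eqP /= le|f l nu nl].
    by have [/(_ le)] := hr f l nu.
  have [_ /(_ nl)] := hr f l nu.
  case: (code l) => [u l'|//|phi l1 l2|//].
    by rewrite mean_supp.
  by case: (satisfies nu phi); rewrite mul1e mul0e ?adde0 ?add0e.
move/le_lt_trans; apply; case: (h c) (h0 c) hfin => // r _ _.
by rewrite -EFinM ltry.
Qed.
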